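(* Let $A$, $\overline{A}=A/tA$, $\widehat{A}$ and $\widehat{\Gamma}$ be as described in the context. The map $$\widehat{\Gamma}:\widehat{A}\to\overline{A},\qquad f(\widehat{q})\mapsto f(0)$$ is a $\mathbf{k}$-algebra epimorphism (surjective homomorphism) such that $$\widehat{\Gamma}(x_i)=x_i,\qquad \widehat{\Gamma}(\widehat{q})=0,\qquad \widehat{\Gamma}(c)=c$$ for $i=1,\ldots,n$ and each $c\in\mathbf{k}$.
   Context: $\mathbf{k}$ is an algebraically closed field of characteristic zero, $\mathbf{k}^*=\mathbf{k}\setminus\{0\}$, $t$ is an indeterminate. All algebras are associative and unital. Setting. $A$ is a $\mathbf{k}[t]$-algebra generated by $x_1,\ldots,x_n$ subject to relations $f_1,\ldots,f_r$, where $f_i=\sum_{\mathbf{x}}a^i_{\mathbf{x}}(t)\mathbf{x}$ with $a^i_{\mathbf{x}}(t)\in\mathbf{k}[t]$ and $\mathbf{x}$ running over monomials (finite products of the $x_j$). Assume: (i) $t$ is a regular element of $A$: a nonzero, nonunit, non-zero-divisor, central element such that $A/tA$ is commutative. Then $\overline{A}:=A/tA$ is a Poisson algebra with bracket $\{\overline{a},\overline{b}\}=\overline{t^{-1}(ab-ba)}$. (ii) For each $q\in\mathbf{k}^*$, $A_q:=A/(t-q)A$ is nonzero. (So $\overline{A}$ and $A_q$ are the $\mathbf{k}$-algebras generated by $x_1,\dots,x_n$ with relations $f_i|_{t=0}$, respectively $f_i|_{t=q}$.) (iii) $A$ has a $\mathbf{k}[t]$-basis $\{\xi_i\mid i\in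 I\}$ such that, for each $q\in\mathbf{k}^*$, the families $\{\xi_i+tA\}_{i\in I}$ and $\{\xi_i+(t-q)A\}_{i\in I}$ are $\mathbf{k}$-bases of $\overline{A}$ and $A_q$ respectively; these images are again written $\xi_i$. For $f(t)=\sum_i a_i(t)\xi_i\in A$ write $f(0)=\overline{f(t)}=\sum_i a_i(0)\xi_i\in\overline{A}$ and $f(q)=\sum_i a_i(q)\xi_i\in A_q$. The algebra $\widehat{A}$. Let $\widehat{q}$ be the parameter taking values in $\mathbf{k}^*$, i.e. the function $\mathbf{k}^*\to\mathbf{k}$, $\widehat{q}(q)=q$. $A_{\widehat{q}}$ is the $\mathbf{k}$-algebra obtained from $A_q$ by replacing $q$ by $\widehat{q}$ (with $\widehat{q}$ a central invertible scalar parameter: generated over $\mathbf{k}[\widehat{q},\widehat{q}^{-1}]$ by $x_1,\ldots,x_n$ with relations $f_i|_{t=\widehat{q}}$). For $f(t)=\sum_i a_i(t)\xi_i\in A$ put $f(\widehat{q})=\sum_i a_i(\widehat{q})\xi_i\in A_{\widehat{q}}$. Let $\gamma:A\to\prod_{q\in\mathbf{k}^*}A_q$, $f(t)\mapsto(f(q))_{q}$, which is an injective $\mathbf{k}$-algebra homomorphism, let $\widehat{\ }:A_{\widehat{q}}\to\prod_{q\in\mathbf{k}^*}A_q$, $f\mapsto(f|_{\widehat{q}=q})_q$, and let $\widehat{A}$ be the preimage of $\gamma(A)$ under $\widehat{\ }$. Let $\widehat{\Gamma}:\widehat{A}\to\overline{A}$ be the composition of $\widehat{\ }:\widehat{A}\to\gamma(A)$,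 $\gamma^{-1}:\gamma(A)\to A$ and the projection $A\to\overline{A}$. *)

(* Defs.v *)
From HB Require Import structures.
From mathcomp Require Import all_boot all_algebra.
From mathcomp Require Import boolp classical_sets functions.
From mathcomp Require Import finmap monalg.

Set Implicit Arguments.
Unset Strict Implicit.
Unset Printing Implicit Defensive.

Import GRing.Theory.
Local Open Scope ring_scope.
Local Open Scope quotient_scope.

Record ideal (A : pzRingType) := Ideal {
  ideal_set :> A -> Prop;
  ideal0 : ideal_set 0;
  idealD : forall a b, ideal_set a -> ideal_set b -> ideal_set (a + b);
  idealMl : forall a b, ideal_set b -> ideal_set (a * b);
  idealMr : forall a b, ideal_set a -> ideal_set (a * b)
}.

Section IdealTheory.
Variables (A : pzRingType) (I : ideal A).

Lemma idealN a : I a -> I (- a).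
Proof. by move=> Ia; rewrite -mulN1r; apply: idealMl. Qed.

Lemma idealB a b : I a -> I b -> I (a - b).
Proof. by move=> Ia Ib; apply: idealD => //; apply: idealN. Qed.

Definition ideal_rel (a b : A) : bool := `[< I (a - b) >].

Lemma ideal_rel_refl : reflexive ideal_rel.
Proof. by move=> a; apply/asboolP; rewrite subrr; apply: ideal0. Qed.

Lemma ideal_rel_sym : symmetric ideal_rel.
Proof.
by move=> a b; apply/asboolP/asboolP => /idealN; rewrite opprB.
Qed.

Lemma ideal_rel_trans : transitive ideal_rel.
Proof.
move=> b a c /asboolP Iab /asboolP Ibc; apply/asboolP.
by rewrite -(subrKA b); apply: idealD.
Qed.

Definition ideal_equiv :=
  EquivRel ideal_rel ideal_rel_refl ideal_rel_sym ideal_rel_trans.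

End IdealTheory.

Definition gen_ideal (A : pzRingType) (S : set A) : ideal A.
Proof.
exists (fun a => forall J : ideal A, (S `<=` J)%classic -> J a).
- by move=> J _; apply: ideal0.
- by move=> a b Ia Ib J SJ; apply: idealD; [apply: Ia | apply: Ib].
- by move=> a b Ib J SJ; apply: idealMl; apply: Ib.
- by move=> a b Ia J SJ; apply: idealMr; apply: Ia.
Defined.

Lemma sub_gen_ideal (A : pzRingType) (S : set A) : (S `<=` gen_ideal S)%classic.
Proof. by move=> a Sa J; apply. Qed.

(* The quotient ring A/I, as a module over R through s : R -> A. It may be the
   zero ring, hence carries a pzRingType structure and not an algType one. *)
Definition alg_quot (R A : pzRingType) (s : {rmorphism R -> A}) (I : ideal A) :=
  {eq_quot (ideal_equiv I)}.

Section AlgQuot.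
Variables (R A : pzRingType) (s : {rmorphism R -> A}) (I : ideal A).

Local Notation Q := (alg_quot s I).

HB.instance Definition _ := Choice.on Q.
HB.instance Definition _ := EqQuotient.on Q.

Definition qpi (a : A) : Q := \pi_Q a.
Definition qrepr (u : Q) : A := repr u.

Lemma qreprK u : qpi (qrepr u) = u.
Proof. exact: reprK. Qed.

Lemma qpiP a b : qpi a = qpi b <-> I (a - b).
Proof.
by split=> [/eqP|?]; [|apply/eqP]; rewrite eqmodE => *; apply/asboolP.
Qed.

Lemma qrepr_pi a : I (qrepr (qpi a) - a).
Proof. by apply/qpiP; rewrite qreprK. Qed.

Lemma qW (P : Q -> Prop) : (forall a, P (qpi a)) -> forall u, P u.
Proof. by move=> h u; rewrite -(qreprK u). Qed.

Let addq (u v : Q) : Q := qpi (qrepr u + qrepr v).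
Let oppq (u : Q) : Q := qpi (- qrepr u).
Let mulq (u v : Q) : Q := qpi (qrepr u * qrepr v).
Let scaleq (c : R) (u : Q) : Q := qpi (s c * qrepr u).

Let pi_add a b : addq (qpi a) (qpi b) = qpi (a + b).
Proof. by apply/qpiP; rewrite opprD addrACA; apply: idealD; apply: qrepr_pi. Qed.

Let pi_opp a : oppq (qpi a) = qpi (- a).
Proof. by apply/qpiP; rewrite -opprD; apply: idealN; apply: qrepr_pi. Qed.

Let pi_mul a b : mulq (qpi a) (qpi b) = qpi (a * b).
Proof.
apply/qpiP.
rewrite -(subrKA (a * qrepr (qpi b))) -mulrBl -mulrBr.
by apply: idealD; [apply: idealMr | apply: idealMl]; apply: qrepr_pi.
Qed.

Let pi_scale c a : scaleq c (qpi a) = qpi (s c * a).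
Proof. by apply/qpiP; rewrite -mulrBr; apply: idealMl; apply: qrepr_pi. Qed.

Let addqA : associative addq.
Proof. by elim/qW=> a; elim/qW=> b; elim/qW=> c; rewrite !pi_add addrA. Qed.
Let addqC : commutative addq.
Proof. by elim/qW=> a; elim/qW=> b; rewrite !pi_add addrC. Qed.
Let add0q : left_id (qpi 0) addq.
Proof. by elim/qW=> a; rewrite pi_add add0r. Qed.
Let addNq : left_inverse (qpi 0) oppq addq.
Proof. by elim/qW=> a; rewrite pi_opp pi_add addNr. Qed.

HB.instance Definition _ := GRing.isZmodule.Build Q addqA addqC add0q addNq.

Let mulqA : associative mulq.
Proof. by elim/qW=> a; elim/qW=> b; elim/qW=> c; rewrite !pi_mul mulrA. Qed.
Let mul1q : left_id (qpi 1) mulq.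
Proof. by elim/qW=> a; rewrite pi_mul mul1r. Qed.
Let mulq1 : right_id (qpi 1) mulq.
Proof. by elim/qW=> a; rewrite pi_mul mulr1. Qed.
Let mulqDl : left_distributive mulq addq.
Proof.
by elim/qW=> a; elim/qW=> b; elim/qW=> c; rewrite pi_add !pi_mul pi_add mulrDl.
Qed.
Let mulqDr : right_distributive mulq addq.
Proof.
by elim/qW=> a; elim/qW=> b; elim/qW=> c; rewrite pi_add !pi_mul pi_add mulrDr.
Qed.

HB.instance Definition _ :=
  GRing.Zmodule_isPzRing.Build Q mulqA mul1q mulq1 mulqDl mulqDr.

Let scaleqA c d u : scaleq c (scaleq d u) = scaleq (c * d) u.
Proof. by elim/qW: u => a; rewrite !pi_scale rmorphM mulrA. Qed.
Let scale1q : left_id 1 scaleq.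
Proof. by elim/qW=> a; rewrite pi_scale rmorph1 mul1r. Qed.
Let pi_addr a b : qpi a + qpi b = qpi (a + b).
Proof. exact: pi_add. Qed.
Let scaleqDr : right_distributive scaleq +%R.
Proof.
move=> c; elim/qW=> a; elim/qW=> b.
by rewrite pi_addr !pi_scale pi_addr mulrDr.
Qed.
Let scaleqDl u : {morph scaleq^~ u : c d / c + d}.
Proof.
by move=> c d /=; elim/qW: u => a; rewrite !pi_scale pi_addr rmorphD mulrDl.
Qed.

HB.instance Definition _ :=
  GRing.Zmodule_isLmodule.Build R Q scaleqA scale1q scaleqDr scaleqDl.

Let qpi_zmod : zmod_morphism qpi.
Proof. by move=> a b; rewrite -pi_add -pi_opp. Qed.
Let qpi_monoid : monoid_morphism qpi.
Proof. by split=> // a b; rewrite -pi_mul. Qed.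

HB.instance Definition _ := GRing.isZmodMorphism.Build A Q qpi qpi_zmod.
HB.instance Definition _ := GRing.isMonoidMorphism.Build A Q qpi qpi_monoid.

Lemma qpiZ c a : qpi (s c * a) = c *: qpi a.
Proof. by rewrite -pi_scale. Qed.

Lemma qpi_eq0 a : qpi a = 0 <-> I a.
Proof. by rewrite -(rmorph0 qpi) qpiP subr0. Qed.

End AlgQuot.

(* Substitution goes through representatives; this makes it independent of them. *)
Lemma qrepr_morph (R A B : pzRingType) (s : {rmorphism R -> A}) (I : ideal A)
    (g : {rmorphism A -> B}) :
  (forall a, I a -> g a = 0) ->
  forall a, g (qrepr (qpi s I a)) = g a.
Proof.
by move=> gI a; apply/eqP; rewrite -subr_eq0 -rmorphB gI //; apply: qrepr_pi.
Qed.

Definition ker_ideal (A B : pzRingType) (g : {rmorphism A -> B}) : ideal A.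
Proof.
exists (fun a => g a = 0).
- exact: rmorph0.
- by move=> a b ga gb; rewrite rmorphD ga gb addr0.
- by move=> a b gb; rewrite rmorphM gb mulr0.
- by move=> a b ga; rewrite rmorphM ga mul0r.
Defined.

Lemma gen_ideal_ker (A B : pzRingType) (g : {rmorphism A -> B}) (S : set A) :
  (forall a, S a -> g a = 0) -> forall a, gen_ideal S a -> g a = 0.
Proof. by move=> gS a /(_ (ker_ideal g)); apply. Qed.

Notation freealg R n := {malg R[{fmonom 'I_n}]}.

Section FreeAlg.
Variables (R : comNzRingType) (n : nat).

Local Notation F := (freealg R n).

Definition fconst : R -> F := @mkmalgU {fmonom 'I_n} R mone.
HB.instance Definition _ := GRing.RMorphism.on fconst.

Definition fvar (i : 'I_n) : F := mkmalgU (fmu i) 1.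

(* The image of P when coefficients are sent along s and variables to x. *)
Definition fev (B : pzRingType) (s : R -> B) (x : 'I_n -> B) (P : F) : B :=
  \sum_(m <- msupp P) s (mcoeff m P) * \prod_(j <- (m : seq 'I_n)) x j.

Lemma fconstC c (P : F) : fconst c * P = P * fconst c.
Proof.
rewrite !malgM_def fgmulUg fgmulgU; apply: eq_bigr => m _.
by rewrite mul1m mulm1 mulrC.
Qed.

Section Fev.
Variables (B : pzRingType) (s : {rmorphism R -> B}) (x : 'I_n -> B).
Hypothesis sx : forall c i, s c * x i = x i * s c.

Lemma fevEw (d : {fset {fmonom 'I_n}}) (P : F) : fsubset (msupp P) d ->
  fev s x P = \sum_(m <- d) s (mcoeff m P) * \prod_(j <- (m : seq 'I_n)) x j.
Proof.
move=> le; rewrite [LHS](big_fset_incl _ le) => //= m _ /mcoeff_outdom ->.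
by rewrite rmorph0 mul0r.
Qed.

Lemma fev_zmod : zmod_morphism (fev s x).
Proof.
move=> P Q.
pose d := fsetU (msupp P) (fsetU (msupp Q) (msupp (P - Q))).
rewrite !(@fevEw d) ?fsubsetUl //; last 2 first.
- by rewrite fsubsetU // fsubsetUl orbT.
- by rewrite fsubsetU // fsubsetU ?orbT // fsubset_refl orbT.
rewrite -sumrB; apply: eq_bigr => m _.
by rewrite raddfB rmorphB mulrBl.
Qed.

Lemma fevU c m : fev s x (mkmalgU m c) = s c * \prod_(j <- (m : seq 'I_n)) x j.
Proof. by rewrite (fevEw msuppU_le) big_seq_fset1 mcoeffUU. Qed.

Lemma fev_monoid : monoid_morphism (fev s x).
Proof.
pose fevZ := GRing.isZmodMorphism.Build F B (fev s x) fev_zmod.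
pose fevA : {additive F -> B} := HB.pack (fev s x) fevZ.
have fsum (T : Type) (r : seq T) (G : T -> F) :
    fev s x (\sum_(i <- r) G i) = \sum_(i <- r) fev s x (G i).
  exact: (raddf_sum fevA).
split=> [|P Q].
  by rewrite fevU rmorph1 mul1r fm1 big_nil.
rewrite malgME fsum mulr_suml; apply: eq_bigr => i _.
rewrite fsum mulr_sumr; apply: eq_bigr => j _.
rewrite fevU rmorphM fmM big_cat /= -!mulrA; congr (_ * _).
rewrite !mulrA; congr (_ * _).
elim: (i : seq 'I_n) => [|l m IH]; first by rewrite !big_nil mulr1 mul1r.
by rewrite !big_cons mulrA sx -mulrA IH mulrA.
Qed.

Lemma fev_const c : fev s x (fconst c) = s c.
Proof. by rewrite fevU fm1 big_nil mulr1. Qed.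

Lemma fev_var i : fev s x (fvar i) = x i.
Proof. by rewrite fevU rmorph1 mul1r fmU big_seq1. Qed.
End Fev.

Lemma fvarE (m : {fmonom 'I_n}) :
  \prod_(j <- (m : seq 'I_n)) fvar j = mkmalgU m 1.
Proof.
case: m => m; elim: m => [|i m IH].
  by rewrite big_nil /= -fmoneE.
rewrite /= big_cons; move: IH => /= ->.
rewrite malgM_def fgmulUU mulr1; congr (mkmalgU _ _).
by rewrite /mmul /mul /= fmmulE fmuE.
Qed.

Lemma fev_uniq (B : pzRingType) (g : {rmorphism F -> B}) P :
  g P = fev (g \o fconst) (g \o fvar) P.
Proof.
rewrite {1}[P]monalgE raddf_sum /=; apply: eq_bigr => m _.
transitivity (g (fconst (mcoeff m P) * \prod_(j <- (m : seq 'I_n)) fvar j)).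
  by rewrite fvarE malgM_def fgmulUU mulr1 mul1m.
by rewrite rmorphM rmorph_prod.
Qed.

Lemma eq_fev (B : pzRingType) (s s' : R -> B) (x x' : 'I_n -> B) :
  s =1 s' -> x =1 x' -> fev s x =1 fev s' x'.
Proof.
move=> ss' xx' P; apply: eq_bigr => m _; rewrite ss'; congr (_ * _).
by apply: eq_bigr.
Qed.

(* The R-algebra generated by x_1, ..., x_n subject to the relations f i. *)
Definition presented (r : nat) (f : 'I_r -> F) :=
  alg_quot fconst (gen_ideal (range f)).

Section Presented.
Variables (r : nat) (f : 'I_r -> F).
Local Notation A := (presented f).

HB.instance Definition _ := GRing.PzRing.on A.
HB.instance Definition _ := GRing.Lmodule.on A.

Definition ppi : F -> A := qpi fconst (gen_ideal (range f)).
HB.instance Definition _ := GRing.RMorphism.on ppi.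

Definition prepr : A -> F := @qrepr _ _ _ _.

Definition pvar (i : 'I_n) : A := ppi (fvar i).

Lemma preprK u : ppi (prepr u) = u.
Proof. exact: qreprK. Qed.

Lemma pscaleE c (u : A) : c *: u = ppi (fconst c) * u.
Proof. by rewrite -(preprK u) -rmorphM /= -qpiZ. Qed.

Lemma pscaleAl c (u v : A) : c *: (u * v) = c *: u * v.
Proof. by rewrite !pscaleE mulrA. Qed.

Lemma pscaleAr c (u v : A) : c *: (u * v) = u * (c *: v).
Proof.
rewrite (pscaleE c (u * v)) (pscaleE c v).
rewrite [LHS]mulrA [RHS]mulrA.
have <- : ppi (prepr u) = u by exact: preprK.
move: (prepr u) => P.
congr (_ * v).
rewrite -(rmorphM ppi).
rewrite fconstC.
by rewrite (rmorphM ppi).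
Qed.

Lemma ppi_rel i : ppi (f i) = 0.
Proof. by apply/qpi_eq0; apply: sub_gen_ideal; exists i. Qed.

Lemma prepr_morph (B : pzRingType) (g : {rmorphism F -> B}) :
  (forall i, g (f i) = 0) -> forall P, g (prepr (ppi P)) = g P.
Proof.
move=> gf; apply: qrepr_morph; apply: gen_ideal_ker => _ [i _ <-].
exact: gf.
Qed.

Definition pscal (c : R) : A := c *: (1 : A).

Lemma pscalE c : pscal c = ppi (fconst c).
Proof. by rewrite /pscal pscaleE mulr1. Qed.

Lemma pscal_zmod : zmod_morphism pscal.
Proof. by move=> c d; rewrite /pscal scalerBl. Qed.
Lemma pscal_monoid : monoid_morphism pscal.
Proof.
split=> [|c d]; first exact: scale1r.
by rewrite !pscalE (rmorphM fconst) (rmorphM ppi).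
Qed.
HB.instance Definition _ := GRing.isZmodMorphism.Build R A pscal pscal_zmod.
HB.instance Definition _ := GRing.isMonoidMorphism.Build R A pscal pscal_monoid.

Lemma pscalC c (u : A) : pscal c * u = u * pscal c.
Proof. by rewrite /pscal -pscaleAl -pscaleAr mul1r mulr1. Qed.

Definition scal_ideal (p : R) : ideal A.
Proof.
exists (fun a => exists b, a = pscal p * b).
- by exists 0; rewrite mulr0.
- by move=> _ _ [a ->] [b ->]; exists (a + b); rewrite mulrDr.
- by move=> a _ [b ->]; exists (a * b); rewrite !mulrA -pscalC.
- by move=> _ b [a ->]; exists (a * b); rewrite mulrA.
Defined.

End Presented.
End FreeAlg.

Definition kstar (k : fieldType) := {q : k | q != 0}.

Section Laurent.
Variable k : fieldType.

Definition laurent_pred : {pred kstar k -> k} := fun h =>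
  `[< exists (p : {poly k}) (m : nat), forall q, h q = p.[val q] / val q ^+ m >].

(* k[qhat, qhat^-1] as a ring of functions on k^*. *)
Record laurent := Laurent {
  laurent_fun :> kstar k -> k;
  laurentP : laurent_fun \in laurent_pred
}.

HB.instance Definition _ := [isSub for laurent_fun].
HB.instance Definition _ := [Choice of laurent by <:].

Lemma laurent_subring : subring_closed laurent_pred.
Proof.
split.
- apply/asboolP; exists 1, 0%N => q.
  by rewrite hornerC expr0 divr1.
- move=> h1 h2 /asboolP[p1 [m1 e1]] /asboolP[p2 [m2 e2]]; apply/asboolP.
  exists (p1 * 'X^m2 - p2 * 'X^m1), (m1 + m2)%N => q.
  have q0 m : val q ^+ m != 0 by rewrite expf_neq0 // (valP q).
  rewrite -[LHS]/(h1 q - h2 q) e1 e2 !hornerE exprD.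
  by rewrite -mulNr addf_div // mulNr.
- move=> h1 h2 /asboolP[p1 [m1 e1]] /asboolP[p2 [m2 e2]]; apply/asboolP.
  exists (p1 * p2), (m1 + m2)%N => q.
  rewrite -[LHS]/(h1 q * h2 q) e1 e2 hornerM exprD.
  by rewrite mulf_div.
Qed.

HB.instance Definition _ :=
  GRing.SubChoice_isSubComPzRing.Build (kstar k -> k) laurent_pred laurent
    laurent_subring.

Lemma laurent_oner_neq0 : (1 : laurent) != 0.
Proof.
apply/eqP => /(congr1 (fun h : laurent => h (exist _ 1 (oner_neq0 k)))).
by move/eqP; rewrite (oner_eq0 k).
Qed.

HB.instance Definition _ :=
  GRing.PzSemiRing_isNonZero.Build laurent laurent_oner_neq0.

Definition leval (q : kstar k) (h : laurent) : k := h q.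

Lemma leval_zmod q : zmod_morphism (leval q).
Proof. by []. Qed.
Lemma leval_monoid q : monoid_morphism (leval q).
Proof. by []. Qed.
HB.instance Definition _ q :=
  GRing.isZmodMorphism.Build laurent k (leval q) (leval_zmod q).
HB.instance Definition _ q :=
  GRing.isMonoidMorphism.Build laurent k (leval q) (leval_monoid q).

Lemma at_qhat_subproof (p : {poly k}) :
  (fun q : kstar k => p.[val q]) \in laurent_pred.
Proof. by apply/asboolP; exists p, 0%N => q; rewrite expr0 divr1. Qed.

Definition at_qhat (p : {poly k}) : laurent := Laurent (at_qhat_subproof p).

Lemma at_qhat_zmod : zmod_morphism at_qhat.
Proof. by move=> p1 p2; apply/val_inj/funext => q; rewrite /= hornerD hornerN. Qed.
Lemma at_qhat_monoid : monoid_morphism at_qhat.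
Proof.
split=> [|p1 p2]; apply/val_inj/funext => q /=; first by rewrite hornerC.
by rewrite hornerM.
Qed.
HB.instance Definition _ :=
  GRing.isZmodMorphism.Build {poly k} laurent at_qhat at_qhat_zmod.
HB.instance Definition _ :=
  GRing.isMonoidMorphism.Build {poly k} laurent at_qhat at_qhat_monoid.

Definition qhat : laurent := at_qhat 'X.

Lemma qhatE q : qhat q = val q.
Proof. by rewrite /= hornerX. Qed.

Definition lconst (c : k) : laurent := at_qhat c%:P.

End Laurent.

Section Deformation.
Variables (k : fieldType) (n r : nat) (f : 'I_r -> freealg {poly k} n).

Local Notation A := (presented f).

Definition tA : A := pscal f 'X.

Definition kscal : k -> A := pscal f \o polyC.
HB.instance Definition _ := GRing.RMorphism.on kscal.

(* A/pA, with k acting through the constants of k[t] *)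
Definition Aquot (p : {poly k}) := alg_quot kscal (scal_ideal f p).

Section Aquot.
Variable p : {poly k}.

HB.instance Definition _ := GRing.PzRing.on (Aquot p).
HB.instance Definition _ := GRing.Lmodule.on (Aquot p).

Definition Api : A -> Aquot p := qpi kscal (scal_ideal f p).
HB.instance Definition _ := GRing.RMorphism.on Api.

Lemma Api_surj u : exists a, Api a = u.
Proof. by exists (@qrepr _ _ kscal (scal_ideal f p) u); apply: qreprK. Qed.

Lemma Api_scal c a : Api (c%:P *: a) = c *: Api a.
Proof. by rewrite -qpiZ /= /pscal -pscaleAl mul1r. Qed.

Lemma AscaleAl c (u v : Aquot p) : c *: (u * v) = c *: u * v.
Proof.
have [a <-] := Api_surj u; have [b <-] := Api_surj v.
by rewrite -rmorphM -!Api_scal -rmorphM pscaleAl.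
Qed.

Lemma AscaleAr c (u v : Aquot p) : c *: (u * v) = u * (c *: v).
Proof.
have [a <-] := Api_surj u; have [b <-] := Api_surj v.
by rewrite -rmorphM -!Api_scal -rmorphM pscaleAr.
Qed.

End Aquot.

Definition Abar := Aquot 'X.
HB.instance Definition _ := GRing.PzRing.on Abar.
HB.instance Definition _ := GRing.Lmodule.on Abar.

Definition Aq (q : kstar k) := Aquot ('X - (val q)%:P).
HB.instance Definition _ q := GRing.PzRing.on (Aq q).
HB.instance Definition _ q := GRing.Lmodule.on (Aq q).

Definition pibar : A -> Abar := Api 'X.
HB.instance Definition _ := GRing.RMorphism.on pibar.

Definition piq (q : kstar k) : A -> Aq q := Api ('X - (val q)%:P).
HB.instance Definition _ q := GRing.RMorphism.on (piq q).

Definition xbar (i : 'I_n) : Abar := pibar (pvar f i).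

Lemma pibar_scale (p : {poly k}) a : pibar (p *: a) = p.[0] *: pibar a.
Proof.
rewrite -Api_scal; apply/eqP; rewrite -subr_eq0 -rmorphB -scalerBl.
have [s ->] : exists s, p - (p.[0])%:P = 'X * s.
  have /factor_theorem[s] : root (p - (p.[0])%:P) 0.
    by rewrite rootE !hornerE subrr.
  by rewrite subr0 mulrC => ->; exists s.
apply/eqP/qpi_eq0; exists (s *: a).
by rewrite /pscal -pscaleAl mul1r scalerA.
Qed.

Lemma piq_scale q (p : {poly k}) a : piq q (p *: a) = p.[val q] *: piq q a.
Proof.
rewrite -Api_scal; apply/eqP; rewrite -subr_eq0 -rmorphB -scalerBl.
have [s ->] : exists s, p - (p.[val q])%:P = ('X - (val q)%:P) * s.
  have /factor_theorem[s] : root (p - (p.[val q])%:P) (val q).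
    by rewrite rootE !hornerE subrr.
  by rewrite mulrC => ->; exists s.
apply/eqP/qpi_eq0; exists (s *: a).
by rewrite /pscal -pscaleAl mul1r scalerA.
Qed.

(* gamma f(t) = (f(q))_q, where f(q) is the class of f(t): see [gamma_value]. *)
Definition gamma (a : A) : forall q, Aq q := fun q => piq q a.

Lemma gamma_zmod a b q : gamma (a - b) q = gamma a q - gamma b q.
Proof. exact: rmorphB. Qed.

(* f|_{t = qhat} for f in the free algebra over k[t] *)
Definition fhat : freealg {poly k} n -> freealg (laurent k) n :=
  fev (@fconst (laurent k) n \o @at_qhat k) (@fvar (laurent k) n).

Lemma fhat_comm (c : {poly k}) i :
  (@fconst (laurent k) n \o @at_qhat k) c * fvar (laurent k) i =
  fvar (laurent k) i * (@fconst (laurent k) n \o @at_qhat k) c.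
Proof. exact: fconstC. Qed.

HB.instance Definition _ :=
  GRing.isZmodMorphism.Build (freealg {poly k} n) (freealg (laurent k) n) fhat
    (fev_zmod _ _).
HB.instance Definition _ :=
  GRing.isMonoidMorphism.Build (freealg {poly k} n) (freealg (laurent k) n) fhat
    (fev_monoid fhat_comm).

Definition Aqhat := presented (fun i => fhat (f i)).
HB.instance Definition _ := GRing.PzRing.on Aqhat.
HB.instance Definition _ := GRing.Lmodule.on Aqhat.

Definition xqhat (i : 'I_n) : Aqhat := pvar (fun i => fhat (f i)) i.

(* The image in A_qhat of an element of A: t is sent to qhat, x_i to x_i. *)
Definition subst_qhat (a : A) : Aqhat :=
  ppi (fun i => fhat (f i)) (fhat (prepr a)).

Lemma subst_qhat_pi P :
  subst_qhat (ppi f P) = ppi (fun i => fhat (f i)) (fhat P).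
Proof.
pose g : {rmorphism _ -> _} := ppi (fun i => fhat (f i)) \o fhat.
rewrite -[LHS]/(g (prepr (ppi f P))) prepr_morph // => i.
exact: (ppi_rel (fun i => fhat (f i))).
Qed.

Section SpecialValue.
Variable q : kstar k.

Definition lscal (h : laurent k) : Aq q := h q *: (1 : Aq q).

Lemma lscal_zmod : zmod_morphism lscal.
Proof. by move=> h1 h2; rewrite /lscal -scalerBl. Qed.
Lemma lscal_monoid : monoid_morphism lscal.
Proof.
split=> [|h1 h2]; first by rewrite /lscal scale1r.
by rewrite /lscal -AscaleAl mul1r scalerA.
Qed.
HB.instance Definition _ :=
  GRing.isZmodMorphism.Build (laurent k) (Aq q) lscal lscal_zmod.
HB.instance Definition _ :=
  GRing.isMonoidMorphism.Build (laurent k) (Aq q) lscal lscal_monoid.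

Lemma lscalC h (u : Aq q) : lscal h * u = u * lscal h.
Proof. by rewrite /lscal -AscaleAl -AscaleAr mul1r mulr1. Qed.

(* P|_{qhat = q} *)
Definition fspec : freealg (laurent k) n -> Aq q :=
  fev lscal (fun i => piq q (pvar f i)).

HB.instance Definition _ :=
  GRing.isZmodMorphism.Build (freealg (laurent k) n) (Aq q) fspec
    (fev_zmod _ _).
HB.instance Definition _ :=
  GRing.isMonoidMorphism.Build (freealg (laurent k) n) (Aq q) fspec
    (fev_monoid (fun h i => lscalC h _)).

Lemma fspec_fhat P : fspec (fhat P) = piq q (ppi f P).
Proof.
pose g1 : {rmorphism _ -> _} := fspec \o fhat.
pose g2 : {rmorphism _ -> _} := piq q \o ppi f.
rewrite -[LHS]/(g1 P) -[RHS]/(g2 P) (fev_uniq g1) (fev_uniq g2).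
apply: eq_fev => [c|i] /=.
  rewrite [fhat _](fev_const _ _ c) [fspec _](fev_const _ _ (at_qhat c)).
  by rewrite -pscalE piq_scale rmorph1.
by rewrite [fhat _](fev_var _ _ i) [fspec _](fev_var _ _ i).
Qed.

End SpecialValue.

Definition hat (u : Aqhat) : forall q, Aq q := fun q => fspec q (prepr u).

Lemma hat_pi P q : hat (ppi _ P) q = fspec q P.
Proof.
apply: prepr_morph => i.
by rewrite -[LHS]/(fspec q (fhat (f i))) fspec_fhat ppi_rel rmorph0.
Qed.

Lemma hat_zmod u v q : hat (u - v) q = hat u q - hat v q.
Proof.
by rewrite -(preprK u) -(preprK v) -rmorphB !hat_pi rmorphB.
Qed.

Lemma hat1 q : hat 1 q = 1.
Proof. by rewrite -(rmorph1 (ppi _)) hat_pi rmorph1. Qed.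

Lemma hatM u v q : hat (u * v) q = hat u q * hat v q.
Proof.
by rewrite -(preprK u) -(preprK v) -rmorphM !hat_pi rmorphM.
Qed.

Lemma hatZ h u q : hat (h *: u) q = h q *: hat u q.
Proof.
rewrite pscaleE hatM hat_pi [fspec _ _](fev_const _ _ h).
by rewrite /lscal -AscaleAl mul1r.
Qed.

Lemma hat_subst a : hat (subst_qhat a) = gamma a.
Proof.
apply: functional_extensionality_dep => q.
by rewrite (hat_pi (fhat (prepr a)) q) (fspec_fhat q (prepr a)) preprK.
Qed.

Definition Ahat_set : set Aqhat := (hat @^-1` range gamma)%classic.

Definition Ahat_pred : {pred Aqhat} := fun u => `[< Ahat_set u >].

Record Ahat := MkAhat { Ahat_val : Aqhat; Ahat_valP : Ahat_val \in Ahat_pred }.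

HB.instance Definition _ := [isSub for Ahat_val].
HB.instance Definition _ := [Choice of Ahat by <:].

Lemma Ahat_predP u : u \in Ahat_pred <-> exists a, forall q, hat u q = gamma a q.
Proof.
split=> [/asboolP[a _ e]|[a e]]; first by exists a => q; rewrite e.
by apply/asboolP; exists a => //; apply: functional_extensionality_dep.
Qed.

Lemma Ahat_subring : subring_closed Ahat_pred.
Proof.
split.
- by apply/Ahat_predP; exists 1 => q; rewrite hat1 /gamma rmorph1.
- move=> u v /Ahat_predP[a ea] /Ahat_predP[b eb]; apply/Ahat_predP.
  by exists (a - b) => q; rewrite hat_zmod ea eb /gamma rmorphB.
- move=> u v /Ahat_predP[a ea] /Ahat_predP[b eb]; apply/Ahat_predP.
  by exists (a * b) => q; rewrite hatM ea eb /gamma rmorphM.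
Qed.

HB.instance Definition _ :=
  GRing.SubChoice_isSubPzRing.Build Aqhat Ahat_pred Ahat Ahat_subring.

Lemma Ahat_scale_subproof (c : k) (u : Ahat) :
  lconst c *: Ahat_val u \in Ahat_pred.
Proof.
have /Ahat_predP[a e] := Ahat_valP u; apply/Ahat_predP.
exists (c%:P *: a) => q.
by rewrite hatZ e /gamma piq_scale /= !hornerC.
Qed.

(* Ahat is not stable under k[qhat, qhat^-1]; it is a k-submodule, k acting
   through the constant functions. *)
Definition Ahat_scale (c : k) (u : Ahat) : Ahat :=
  MkAhat (Ahat_scale_subproof c u).

Let AscaleA c d u : Ahat_scale c (Ahat_scale d u) = Ahat_scale (c * d) u.
Proof. by apply: val_inj; rewrite /= scalerA /lconst -rmorphM polyCM. Qed.
Let Ascale1 : left_id 1 Ahat_scale.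
Proof. by move=> u; apply: val_inj; rewrite /= /lconst polyC1 rmorph1 scale1r. Qed.
Let AscaleDr : right_distributive Ahat_scale +%R.
Proof. by move=> c u v; apply: val_inj; rewrite /= scalerDr. Qed.
Let AscaleDl u : {morph Ahat_scale^~ u : c d / c + d}.
Proof.
by move=> c d; apply: val_inj; rewrite /= /lconst polyCD rmorphD scalerDl.
Qed.

HB.instance Definition _ :=
  GRing.Zmodule_isLmodule.Build k Ahat AscaleA Ascale1 AscaleDr AscaleDl.

Lemma Ahat_range (u : Ahat) : range gamma (hat (\val u)).
Proof. exact: asboolW (Ahat_valP u). Qed.

(* gamma is injective under the standing hypotheses, so that there is only one
   preimage to choose. *)
Definition gamma_inv (y : forall q, Aq q) (hy : range gamma y) : A :=
  sval (cid2 hy).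

Lemma gamma_invK y (hy : range gamma y) : gamma (gamma_inv hy) = y.
Proof. by rewrite /gamma_inv; case: cid2. Qed.

Definition Gammahat (u : Ahat) : Abar := pibar (gamma_inv (Ahat_range u)).

End Deformation.

Definition lincomb (R : nzRingType) (V : lmodType R) (I : choiceType)
    (xi : I -> V) (c : {malg R[I]}) : V :=
  \sum_(i <- msupp c) mcoeff i c *: xi i.

Definition is_basis (R : nzRingType) (V : lmodType R) (I : choiceType)
    (xi : I -> V) :=
  forall v, exists! c, v = lincomb xi c.

Section Values.
Variables (k : fieldType) (n r : nat) (f : 'I_r -> freealg {poly k} n).
Variables (I : choiceType) (xi : I -> presented f) (a : {malg {poly k}[I]}).

(* The values f(0), f(q) and f(qhat) of f(t) = sum_i a_i(t) xi_i, given the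
   coordinates a of f(t) in the basis xi. *)
Definition value0 : Abar f :=
  \sum_(i <- msupp a) (mcoeff i a).[0] *: pibar (xi i).

Definition valueq (q : kstar k) : Aq f q :=
  \sum_(i <- msupp a) (mcoeff i a).[val q] *: piq q (xi i).

Definition valueqhat : Aqhat f :=
  \sum_(i <- msupp a) at_qhat (mcoeff i a) *: subst_qhat (xi i).

Lemma pibar_value : pibar (lincomb xi a) = value0.
Proof. by rewrite raddf_sum; apply: eq_bigr => i _; apply: pibar_scale. Qed.

Lemma gamma_value : gamma (lincomb xi a) = valueq.
Proof.
apply: functional_extensionality_dep => q.
by rewrite /gamma raddf_sum; apply: eq_bigr => i _; apply: piq_scale.
Qed.

End Values.

Definition t_regular (k : fieldType) (n r : nat)
    (f : 'I_r -> freealg {poly k} n) :=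
  [/\ tA f != 0,
      ~ (exists u, tA f * u = 1 /\ u * tA f = 1),
      forall a, (tA f * a = 0 -> a = 0) /\ (a * tA f = 0 -> a = 0),
      forall a, tA f * a = a * tA f
    & commutative (@GRing.mul (Abar f))].

(* Main.v *)
(* The specialization map from A_qhat to the product of the A_q is injective:
   multiplying by a power of the unit qhat clears the denominators of an
   element u, so that qhat^m u comes from some a in A; if all the
   specializations of u vanish then so does gamma a, and a = 0 because its
   coordinates in the basis xi are polynomials vanishing on k^*.  Hence Ahat is
   a copy of A, and Gammahat is the projection of A onto A/tA. *)
Require Import Defs.
From HB Require Import structures.
From mathcomp Require Import all_boot all_algebra.
From mathcomp Require Import boolp classical_sets functions.
From mathcomp Require Import finmap monalg.

Set Implicit Arguments.
Unset Strict Implicit.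
Unset Printing Implicit Defensive.

Import GRing.Theory.
Local Open Scope ring_scope.

(** A nonzero [p] makes [p * 'X] nonzero, which then has a non-root since the field is closed; the
    factor ['X] forces this point into [kstar k]. *)
Lemma poly_eq0_kstar (k : closedFieldType) (p : {poly k}) :
  (forall q : kstar k, p.[val q] = 0) -> p = 0.
Proof.
move=> p0; apply/eqP/negPn/negP => pN0.
have /closed_nonrootP[x] : p * 'X != 0 by rewrite mulf_neq0 ?polyX_eq0.
rewrite rootM rootX negb_or => /andP[px x0]; move: px.
by rewrite rootE (p0 (exist _ x x0)) eqxx.
Qed.

Lemma lincombEw (R : nzRingType) (V : lmodType R) (I : choiceType)
    (xi : I -> V) (c : {malg R[I]}) (d : {fset I}) :
  fsubset (msupp c) d -> lincomb xi c = \sum_(i <- d) mcoeff i c *: xi i.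
Proof.
move=> le; rewrite [LHS](big_fset_incl _ le) => //= i _ /mcoeff_outdom ->.
by rewrite scale0r.
Qed.

(** This is uniqueness of the coordinates of [0]. The index set [d] is arbitrary because [g] may
    vanish on part of it, as coefficients specialized at [q] can. *)
Lemma is_basis_sum_eq0 (R : nzRingType) (V : lmodType R) (I : choiceType)
    (xi : I -> V) (d : {fset I}) (g : I -> R) :
  is_basis xi -> \sum_(i <- d) g i *: xi i = 0 -> {in d, forall i, g i = 0}.
Proof.
move=> xi_basis sum0.
(* [c] is [g] cut off to [d], so both [c] and [0] are coordinates of the zero vector. *)
pose c : {malg R[I]} := \sum_(i <- d) mkmalgU i (g i).
have cE i : mcoeff i c = if i \in d then g i else 0.
  rewrite /c raddf_sum /=; under eq_bigr do rewrite mcoeffU.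
  case: ifP => id.
    rewrite (big_fsetD1 _ id) /= eqxx /= big1_seq ?addr0 // => j.
    by rewrite /= in_fsetD1 => /andP[/negPf ->].
  rewrite big1_seq // => j /= jd; case: eqP => // ji.
  by rewrite -ji jd in id.
have sub : fsubset (msupp c) d.
  apply/fsubsetP => i; rewrite -mcoeff_neq0 cE.
  by case: ifP => //; rewrite eqxx.
have c0 : 0 = lincomb xi c.
  rewrite (lincombEw _ sub) -[LHS]sum0 [RHS]big_seq [LHS]big_seq.
  by apply: eq_bigr => i id; rewrite cE id.
have z0 : 0 = lincomb xi (0 : {malg R[I]}).
  by rewrite /lincomb msupp0 big_seq_fset0.
have [c' [_ uniq_c']] := xi_basis 0.
have ceq0 : c = 0 by rewrite -(uniq_c' _ c0) -(uniq_c' _ z0).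
by move=> i id; move: (cE i); rewrite id ceq0 mcoeff0.
Qed.

Section Specialization.
Variables (k : fieldType) (n r : nat) (f : 'I_r -> freealg {poly k} n).

Local Notation A := (presented f).
Local Notation subst_qhat := (@subst_qhat k n r f).

Lemma subst_qhat_zmod : zmod_morphism subst_qhat.
Proof.
move=> a b; rewrite -(preprK a) -(preprK b) -(rmorphB (ppi f)).
by rewrite !subst_qhat_pi !rmorphB.
Qed.

Lemma subst_qhat_monoid : monoid_morphism subst_qhat.
Proof.
split=> [|a b]; first by rewrite -(rmorph1 (ppi f)) subst_qhat_pi !rmorph1.
rewrite -(preprK a) -(preprK b) -(rmorphM (ppi f)).
by rewrite !subst_qhat_pi !rmorphM.
Qed.

HB.instance Definition _ :=
  GRing.isZmodMorphism.Build A (Aqhat f) subst_qhat subst_qhat_zmod.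
HB.instance Definition _ :=
  GRing.isMonoidMorphism.Build A (Aqhat f) subst_qhat subst_qhat_monoid.

Lemma fhatU (p : {poly k}) m :
  fhat (mkmalgU m p : freealg {poly k} n) = mkmalgU m (at_qhat p).
Proof.
rewrite [LHS]fevU fvarE malgM_def fgmulUU mulr1.
by rewrite mul1m.
Qed.

Lemma subst_qhat_scale (p : {poly k}) a :
  subst_qhat (p *: a) = at_qhat p *: subst_qhat a.
Proof. by rewrite !pscaleE rmorphM /= subst_qhat_pi [fhat _]fhatU. Qed.

Lemma subst_qhat_lincomb (I : choiceType) (xi : I -> A) c :
  subst_qhat (lincomb xi c) = valueqhat xi c.
Proof. by rewrite raddf_sum; apply: eq_bigr => i _; apply: subst_qhat_scale. Qed.

Lemma at_qhatXn m : at_qhat 'X^m = qhat k ^+ m.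
Proof. by rewrite rmorphXn. Qed.

(** Each monomial has a coefficient of the form [p / q ^ m]; finitely many such terms are brought to
    a common denominator. *)
Lemma clear_denominators (u : Aqhat f) :
  exists m a, qhat k ^+ m *: u = subst_qhat a.
Proof.
rewrite -(preprK u) [prepr _]monalgE rmorph_sum /=.
apply: (big_ind (fun v => exists m a, qhat k ^+ m *: v = subst_qhat a)).
- by exists 0%N, 0; rewrite scaler0 raddf0.
- move=> v w [m [a ea]] [l [b eb]]; exists (m + l)%N, ('X^l *: a + 'X^m *: b).
  rewrite scalerDr raddfD /= !subst_qhat_scale !at_qhatXn -ea -eb !scalerA.
  by rewrite -!exprD [(l + m)%N]addnC.
- move=> x _; set h := mcoeff _ _; have /asboolP[p [m hE]] := laurentP h.
  exists m, (ppi f (mkmalgU x p)); rewrite subst_qhat_pi fhatU pscaleE -rmorphM.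
  rewrite malgM_def fgmulUU mul1m; congr (ppi _ (mkmalgU _ _)).
  (* Elements of [laurent k] are functions on [kstar k], so the power of [q] cancels pointwise. *)
  apply: val_inj; apply: functional_extensionality_dep => q /=.
  rewrite -at_qhatXn -[LHS]/('X^m.[val q] * h q) hornerXn hE mulrC divfK //.
  by rewrite expf_neq0 // (valP q).
Qed.

(** The function [1 / q ^ m] is an inverse of [qhat k ^+ m] in [laurent k]. *)
Lemma qhatX_scale_inj m (u : Aqhat f) : qhat k ^+ m *: u = 0 -> u = 0.
Proof.
move=> u0.
have inv_laurent : (fun q : kstar k => 1 / val q ^+ m) \in @laurent_pred k.
  by apply/asboolP; exists 1, m => q; rewrite hornerC.
have <- : Laurent inv_laurent *: (qhat k ^+ m *: u) = u.
  rewrite scalerA -[RHS]scale1r; congr (_ *: _).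
  apply: val_inj; apply: functional_extensionality_dep => q /=.
  rewrite -at_qhatXn -[LHS]/(1 / val q ^+ m * 'X^m.[val q]) hornerXn divfK //.
  by rewrite expf_neq0 // (valP q).
by rewrite u0 scaler0.
Qed.

End Specialization.

Section Injectivity.
Variables (k : closedFieldType) (n r : nat) (f : 'I_r -> freealg {poly k} n).
Variables (I : choiceType) (xi : I -> presented f).
Hypothesis xi_basis : is_basis xi.
Hypothesis xi_basisq : forall q : kstar k, is_basis (fun i => piq q (xi i)).

(** Specializing the coordinates of [a] at [q] gives coordinates of [0] in the basis of [Aq f q],
    hence zero for every [q]. *)
Lemma gamma_eq0 (a : presented f) : (forall q, gamma a q = 0) -> a = 0.
Proof.
have [c [-> _]] := xi_basis a => a0.
rewrite /lincomb big_seq big1 // => i ic.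
rewrite (@poly_eq0_kstar _ (mcoeff i c)) ?scale0r // => q.
have := a0 q; rewrite gamma_value => /(is_basis_sum_eq0 (@xi_basisq q)).
exact.
Qed.

Lemma gamma_inj (a b : presented f) : (forall q, gamma a q = gamma b q) -> a = b.
Proof.
move=> ab; apply/eqP; rewrite -subr_eq0; apply/eqP/gamma_eq0 => q.
by rewrite gamma_zmod ab subrr.
Qed.

Lemma hat_eq0 (u : Aqhat f) : (forall q, hat u q = 0) -> u = 0.
Proof.
move=> u0; have [m [a ea]] := clear_denominators u.
apply: (@qhatX_scale_inj _ _ _ _ m); rewrite ea (@gamma_eq0 a) ?raddf0 // => q.
by rewrite -hat_subst -ea hatZ u0 scaler0.
Qed.

(** Membership gives [a] with the same specializations as [u], and [hat] separates elements. *)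
Lemma Ahat_subst (u : Ahat f) : exists a, \val u = subst_qhat a.
Proof.
have /Ahat_predP[a ea] := Ahat_valP u; exists a.
apply/eqP; rewrite -subr_eq0; apply/eqP/hat_eq0 => q.
by rewrite hat_zmod ea hat_subst subrr.
Qed.

(** This frees [Gammahat] from the preimage chosen in [gamma_inv]: any [a] mapping to [u] computes
    the value. *)
Lemma GammahatE (u : Ahat f) a : \val u = subst_qhat a -> Gammahat u = pibar a.
Proof.
move=> ua; congr (pibar _); apply: gamma_inj => q.
by rewrite gamma_invK ua hat_subst.
Qed.

Lemma Gammahat_subst (a : presented f) :
  exists2 u : Ahat f, \val u = subst_qhat a & Gammahat u = pibar a.
Proof.
have ua : subst_qhat a \in @Ahat_pred k n r f.
  by apply/Ahat_predP; exists a => q; rewrite hat_subst.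
by exists (MkAhat ua); rewrite // (@GammahatE (MkAhat ua) a).
Qed.

End Injectivity.

Theorem proposition2p5 (k : closedFieldType) (k_char0 : [pchar k] =i pred0)
    (n r : nat) (f : 'I_r -> freealg {poly k} n)
    (t_reg : t_regular f)
    (Aq_neq0 : forall q : kstar k, (1 : Aq f q) != 0)
    (I : choiceType) (xi : I -> presented f)
    (xi_basis : is_basis xi)
    (xi_basis0 : is_basis (fun i => pibar (xi i)))
    (xi_basisq : forall q : kstar k, is_basis (fun i => piq q (xi i))) :
  (* Gammahat : Ahat -> Abar is a k-algebra epimorphism *)
  [/\ GRing.monoid_morphism (@Gammahat k n r f),
      linear (@Gammahat k n r f)
    & forall y : Abar f, exists u : Ahat f, Gammahat u = y] /\
  (* it is the map f(qhat) |-> f(0) *)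
  (forall u : Ahat f, exists a : {malg {poly k}[I]}, \val u = valueqhat xi a) /\
  (forall a : {malg {poly k}[I]},
     exists2 u : Ahat f, \val u = valueqhat xi a & Gammahat u = value0 xi a) /\
  (* its values at the x_i, at qhat and at the constants *)
  [/\ forall i : 'I_n,
        exists2 u : Ahat f, \val u = xqhat f i & Gammahat u = xbar f i,
      exists2 u : Ahat f, \val u = qhat k *: (1 : Aqhat f) & Gammahat u = 0
    & forall c : k,
        exists2 u : Ahat f, \val u = lconst c *: (1 : Aqhat f) &
          Gammahat u = c *: (1 : Abar f)].
Proof.
have GE := GammahatE xi_basis xi_basisq.
have Gsubst := Gammahat_subst xi_basis xi_basisq.
have Asubst := Ahat_subst xi_basis xi_basisq.
split; [split | split; [|split; [|split]]].
- split=> [|u v]; first by rewrite (GE 1 1) ?rmorph1.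
  have [a ua] := Asubst u; have [b vb] := Asubst v.
  rewrite (GE _ _ ua) (GE _ _ vb) -(rmorphM (@pibar k n r f)); apply: GE.
  have -> : \val (u * v) = \val u * \val v by exact: (rmorphM (val : Ahat f -> _)).
  by rewrite ua vb (rmorphM (@subst_qhat k n r f)).
- move=> c u v.
  have [a ua] := Asubst u; have [b vb] := Asubst v.
  rewrite (GE _ _ ua) (GE _ _ vb).
  (* Reading [c] as the value at 0 of a constant polynomial lifts the scalar action from [Abar f] to
     [presented f]. *)
  rewrite -[c in RHS](hornerC c 0) -pibar_scale -(raddfD (@pibar k n r f)); apply: GE.
  have -> : \val (c *: u + v) = lconst c *: \val u + \val v.
    exact: (raddfD (val : Ahat f -> _)).
  by rewrite ua vb -subst_qhat_scale (raddfD (@subst_qhat k n r f)).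
- move=> y; have [a <-] := Api_surj y.
  by have [u _ ua] := Gsubst a; exists u.
- move=> u; have [a ua] := Asubst u; have [c [ac _]] := xi_basis a.
  by exists c; rewrite ua ac subst_qhat_lincomb.
- move=> c; have [u ua uc] := Gsubst (lincomb xi c).
  by exists u; rewrite -?subst_qhat_lincomb // uc pibar_value.
- move=> i; have [u ua uc] := Gsubst (pvar f i); exists u => //.
  by rewrite ua subst_qhat_pi [fhat _]fhatU rmorph1.
(* The element [qhat] comes from [t], whose class in [Abar f] vanishes because ['X] is zero at 0. *)
- have [u ua uc] := Gsubst ('X *: (1 : presented f)); exists u.
    by rewrite ua subst_qhat_scale rmorph1.
  by rewrite uc pibar_scale hornerX scale0r.
- move=> c; have [u ua uc] := Gsubst (c%:P *: (1 : presented f)); exists u.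
    by rewrite ua subst_qhat_scale rmorph1.
  by rewrite uc pibar_scale hornerC (rmorph1 (@pibar k n r f)).
Qed.
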